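(* (Local cover theorem) Let $U$ be a left or middle $i$-piece in the bottom-left packing of the subinstance $\mathcal{I}_i$ consisting of the first $i$ squares. Then $U$ can be covered by at most four copies of the squares that are adjacent to $U$; that is, there is a family of translates of squares adjacent to $U$, in which each such square is used at most four times, whose union contains $U$.
   Context: Consider an instance of the Square Strip Packing Problem with strip width $W$ and an ordering $S_1,\dots,S_n$ with its bottom-left packing (each square in turn is placed, without overlapping interiors and inside $[0,W]\times[0,\infty)$, at the feasible position $(x,y)$ with $(y,x)$ lexicographically minimal). Squares are closed sets. $\mathcal{I}_i$ is the subinstance consisting of $S_1,\dots,S_i$ (whose bottom-left packing coincides with the first $i$ placements). $i$-pieces: inductively for $i=1,\dots,n$, the $i$-pieces are the bounded connected components of $([0,W]\times[0,\infty))\setminus\big(\bigcup_{j\le i}S_j\cup\bigcup\{\text{$k$-pieces},\,k<i\}\big)$. A square $S$ is adjacent to a piece $U$ if $\overline U\cap S\ne\varnothing$. A piece is a left piece if it is adjacent to the left strip boundary $\{0\}\times\mathbb{R}_{\ge0}$ (i.e., its closure meets it), a right piece if adjacent to the right strip boundary $\{W\}\times\mathbb{R}_{\ge0}$, and a middle piece otherwise. *)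

(* Defs.v *)
From HB Require Import structures.
From mathcomp Require Import all_boot all_order all_algebra.
From mathcomp Require Import all_classical all_reals all_analysis.
Set Implicit Arguments.
Unset Strict Implicit.
Unset Printing Implicit Defensive.
Import Order.TTheory GRing.Theory Num.Theory numFieldNormedType.Exports.
Local Open Scope classical_set_scope.
Local Open Scope ring_scope.

Section SSP.
Variable R : realType.
Notation point := (R * R)%type.

Definition sq (p : point) (a : R) : set point :=
  [set q | p.1 <= q.1 <= p.1 + a /\ p.2 <= q.2 <= p.2 + a].

Definition sq_int (p : point) (a : R) : set point :=
  [set q | p.1 < q.1 < p.1 + a /\ p.2 < q.2 < p.2 + a].

Definition strip (W : R) : set point :=
  [set q | 0 <= q.1 <= W /\ 0 <= q.2].

Definition feasible (W : R) (s : nat -> R) (pos : nat -> point)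
  (k : nat) (p : point) : Prop :=
  [/\ 0 <= p.1, p.1 + s k <= W, 0 <= p.2 &
      forall j, (j < k)%N -> sq_int p (s k) `&` sq_int (pos j) (s j) = set0].

Definition BL_packing (W : R) (n : nat) (s : nat -> R) (pos : nat -> point)
  : Prop :=
  forall k, (k < n)%N ->
    feasible W s pos k (pos k) /\
    forall p, feasible W s pos k p ->
      (pos k).2 < p.2 \/ ((pos k).2 = p.2 /\ (pos k).1 <= p.1).

Definition bounded_pt (A : set point) : Prop :=
  exists M : R, forall q, A q -> `|q.1| <= M /\ `|q.2| <= M.

Definition bounded_components (A : set point) : set (set point) :=
  [set C | (exists x, A x /\ C = @connected_component (R * R)%type A x) /\ bounded_pt C].

(* removed s pos i = (squares with 0-based index j < i, i.e. S_1..S_i)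
   union (all k-pieces, 1 <= k < i) *)
Fixpoint removed (W : R) (s : nat -> R) (pos : nat -> point) (i : nat)
  : set point :=
  match i with
  | 0 => set0
  | i'.+1 =>
      removed W s pos i' `|` sq (pos i') (s i') `|`
      (if i' is 0 then set0
       else \bigcup_(U in bounded_components (strip W `\` removed W s pos i')) U)
  end.

Definition pieces (W : R) (s : nat -> R) (pos : nat -> point) (i : nat)
  : set (set point) :=
  bounded_components (strip W `\` removed W s pos i).

Definition adjacent_to (S U : set point) : Prop := closure U `&` S !=set0.

Definition left_piece (W : R) (U : set point) : Prop :=
  closure U `&` [set q : point | q.1 = 0 /\ 0 <= q.2] !=set0.

Definition right_piece (W : R) (U : set point) : Prop :=
  closure U `&` [set q : point | q.1 = W /\ 0 <= q.2] !=set0.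

Definition middle_piece (W : R) (U : set point) : Prop :=
  ~ left_piece W U /\ ~ right_piece W U.

End SSP.

(* Main.v *)
(* Let S be the last square and p a point of the piece U. Every square k rests
   on a square (or the floor) and leans on a square (or the wall) to its left;
   iterating gives a left chain and a down chain, and a point lying under the
   one and to the left of the other is cut off as soon as k is placed. As U is
   first cut off by S, no point of U lies in such a corner for k <> S. Hence the
   left chain of every k <> S to the right of p runs under p, and since a chain
   descends by at most its horizontal extent, the height of k above p is less
   than its distance to the right of p.
   Let c be the first square above p, and suppose that two copies of c put below
   c do not reach p. Look right from two points of the column between p and c.
   If a square so seen is at least as large as its distance from the column, its
   copies to the left and to the lower left cover p. Otherwise either both rays
   see S, which is then at least as large as c and lower, so that c would fit in
   the place of S; or everything obstructing a placement of c to the right of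
   the column is lower than c. Either way c was not placed at the lowest feasible
   position. *)
Require Import Defs.
From HB Require Import structures.
From mathcomp Require Import all_boot all_order all_algebra.
From mathcomp Require Import all_classical all_reals all_analysis.
From mathcomp Require Import lra.
Set Implicit Arguments.
Unset Strict Implicit.
Unset Printing Implicit Defensive.
Import Order.TTheory GRing.Theory Num.Theory numFieldNormedType.Exports.
Local Open Scope classical_set_scope.
Local Open Scope ring_scope.

(** * Maxima over finitely many indices *)

(** The starting value [t0] stands for a wall or a base height, so that the maximum makes sense when
    no index satisfies [P]. *)
Lemma bounded_max (R : realDomainType) (P : nat -> Prop) (f : nat -> R)
    (t0 : R) (m : nat) :
  exists t, [/\ t0 <= t, forall j, (j < m)%N -> P j -> f j <= t &
    t = t0 \/ exists j, [/\ (j < m)%N, P j & t = f j]].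
Proof.
elim: m => [|m [t [t0t tub tE]]]; first by exists t0; split => //; left.
have tE' : t = t0 \/ exists j, [/\ (j < m.+1)%N, P j & t = f j].
  case: tE => [->|[j [jm Pj ->]]]; [by left|right; exists j; split => //].
  exact: ltnW.
have [[Pm tfm]|nm] := pselect (P m /\ t < f m).
  exists (f m); split; first by rewrite (le_trans t0t) // ltW.
    move=> j; rewrite ltnS leq_eqVlt => /orP[/eqP -> //|jm Pj].
    by rewrite (le_trans (tub _ jm Pj)) // ltW.
  by right; exists m; split.
exists t; split => // j; rewrite ltnS leq_eqVlt => /orP[/eqP -> Pm|jm Pj].
  by rewrite leNgt; apply/negP => tfm; apply: nm.
exact: tub.
Qed.

Lemma exists_max (R : realDomainType) (P : nat -> Prop) (f : nat -> R)
    (m j0 : nat) : (j0 < m)%N -> P j0 ->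
  exists j, [/\ (j < m)%N, P j & forall l, (l < m)%N -> P l -> f l <= f j].
Proof.
move=> j0m Pj0; have [t [t0 tub tE]] := bounded_max P f (f j0) m.
case: tE => [tE|[j [jm Pj tE]]]; last by exists j; rewrite -tE; split.
by exists j0; rewrite -tE; split.
Qed.

(** * Locally constant predicates on connected sets *)

Section connectedness.
Context {R : realType}.
Implicit Types (A : set (R * R)) (p : R * R).

(** The part of [A] in [P] is the trace on [A] of the interior of [A -> P] and of the complement of
    the interior of [A -> ~ P], hence relatively clopen. *)
Lemma connected_locally_constant A (P : set (R * R)) :
  connected A ->
  (forall p, A p -> \forall q \near p, A q -> (P q <-> P p)) ->
  forall p, A p -> P p -> A `<=` P.
Proof.
move=> cA lc p Ap Pp.
suff <- : A `&` P = A by exact: subIsetr.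
apply: cA; first by exists p.
- exists (interior [set q | A q -> P q]); first exact: open_interior.
  apply/seteqP; split => q [Aq Pq]; split => //.
    by apply: filterS (lc q Aq) => r Ar /Ar ->.
  exact: (interior_subset Pq).
- exists (~` interior [set q | A q -> ~ P q]).
    exact/open_closedC/open_interior.
  apply/seteqP; split => q [Aq Pq]; split => //.
    by move=> /interior_subset /(_ Aq).
  apply: contrapT => nPq; apply: Pq.
  by apply: filterS (lc q Aq) => r Ar /Ar ->.
Qed.

End connectedness.

(** * Chains of supporting squares *)

Section support_chain.
Context {R : realType}.
Implicit Types (x y s : nat -> R) (sup : nat -> nat) (a b : R) (k n : nat).

(* [below x y sup k a b]: at abscissa [a], the height [b] lies under the
   chain of squares [k], [sup k], [sup (sup k)], ... running to the left of
   [k]. Exchanging the roles of [x] and [y] turns this into "to the left of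
   the chain of squares running down from [k]". *)
Inductive below x y sup : nat -> R -> R -> Prop :=
| below_head k a b : x k <= a -> b < y k -> below x y sup k a b
| below_tail k a b : a < x k -> below x y sup (sup k) a b ->
    below x y sup k a b.

Lemma below_headE x y sup k a b : x k <= a ->
  below x y sup k a b <-> b < y k.
Proof.
move=> xka; split; last exact: below_head.
by move=> H; inversion H => //; subst; lra.
Qed.

Lemma below_tailE x y sup k a b : a < x k ->
  below x y sup k a b <-> below x y sup (sup k) a b.
Proof.
move=> axk; split; last exact: below_tail.
by move=> H; inversion H => //; subst; lra.
Qed.

Definition supported x y s sup n := forall k, (k < n)%N -> 0 < x k ->
  [/\ (sup k < k)%N, x (sup k) + s (sup k) = x k,
      y k < y (sup k) + s (sup k) & y (sup k) < y k + s k].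

Definition off_squares x y s n a b := forall j, (j < n)%N ->
  [\/ a < x j, x j + s j < a, b < y j | y j + s j < b].

Lemma off_squares_leq x y s m n a b : (m <= n)%N ->
  off_squares x y s n a b -> off_squares x y s m a b.
Proof. by move=> mn off j jm; apply: off; apply: leq_trans jm mn. Qed.

Lemma off_squares_swap x y s n a b :
  off_squares x y s n a b -> off_squares y x s n b a.
Proof.
by move=> off j /off[]; [constructor 3|constructor 4|constructor 1|
  constructor 2].
Qed.

Variables (n : nat) (x y s : nat -> R).
Hypothesis s_gt0 : forall k, (k < n)%N -> 0 < s k.
Hypothesis x_ge0 : forall k, (k < n)%N -> 0 <= x k.

(** The deciding square changes only at an abscissa [x k], where [k] and its support overlap
    vertically, so that a point off both is under both or over both. The maps [u] and [v] let the
    statement serve for either order of the coordinates. *)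
Lemma below_locally_constant sup k a b (T : Type) (F : set_system T)
    (FF : Filter F) (u v : T -> R) :
  supported x y s sup n -> (k < n)%N -> 0 <= a -> a < x k + s k ->
  off_squares x y s k.+1 a b -> u @ F --> a -> v @ F --> b ->
  \forall q \near F, 0 <= u q ->
    (below x y sup k (u q) (v q) <-> below x y sup k a b).
Proof.
move=> supp; elim/ltn_ind: k => k IH kn a0 ak off ua vb.
have sk := s_gt0 kn.
have head : x k <= a -> b < y k \/ y k + s k < b.
  move=> xa; case: (off k (leqnn _)) => ?; [lra|lra|by left|by right].
have [xa|ax|xa] := ltgtP (x k) a.
- case: (head (ltW xa)) => hb.
    near=> q => uq0.
    have xu : x k < u q by near: q; exact: cvgr_gt ua _ _.
    have vy : v q < y k by near: q; exact: cvgr_lt vb _ _.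
    by rewrite !below_headE ?ltW //; split; lra.
  near=> q => uq0.
  have xu : x k < u q by near: q; exact: cvgr_gt ua _ _.
  have vy : y k + s k < v q by near: q; exact: cvgr_gt vb _ _.
  by rewrite !below_headE ?ltW //; split; lra.
- have [sk1 xE _ _] := supp k kn (le_lt_trans a0 ax).
  have IHs := IH _ sk1 (ltn_trans sk1 kn) a0.
  rewrite xE in IHs.
  have {}IHs := IHs ax (off_squares_leq (leqW sk1) off) ua vb.
  near=> q => uq0.
  have ux : u q < x k by near: q; exact: cvgr_lt ua _ _.
  rewrite (below_tailE _ _ _ ax) (below_tailE _ _ _ ux).
  move: uq0; near: q; exact: IHs.
have sa : x k <= a by lra.
(* A square at the wall has no support; there [0 <= u q] keeps [k] itself as the deciding square. *)
have [x0|x0] := lerP (x k) 0.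
  have xk0 : x k = 0 by apply/eqP; rewrite eq_le x0 x_ge0.
  case: (head sa) => hb.
    near=> q => uq0.
    have vy : v q < y k by near: q; exact: cvgr_lt vb _ _.
    have xu : x k <= u q by rewrite xk0.
    by rewrite !below_headE //; split; lra.
  near=> q => uq0.
  have vy : y k + s k < v q by near: q; exact: cvgr_gt vb _ _.
  have xu : x k <= u q by rewrite xk0.
  by rewrite !below_headE //; split; lra.
have [sk1 xE yk ysk] := supp k kn x0.
have ssk := s_gt0 (ltn_trans sk1 kn).
have off' := off (sup k) (leqW sk1).
case: (head sa) => hb.
  have hb' : b < y (sup k) by case: off'; lra.
  near=> q => uq0.
  have ux : x (sup k) < u q by near: q; apply: (cvgr_gt a ua); lra.
  have vy : v q < y k by near: q; exact: cvgr_lt vb _ _.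
  have vy' : v q < y (sup k) by near: q; exact: cvgr_lt vb _ _.
  rewrite (below_headE _ _ _ sa).
  have [xu|xu] := lerP (x k) (u q); first by rewrite below_headE.
  by rewrite below_tailE // below_headE ?ltW //; split; lra.
have hb' : y (sup k) + s (sup k) < b by case: off'; lra.
near=> q => uq0.
have ux : x (sup k) < u q by near: q; apply: (cvgr_gt a ua); lra.
have vy : y k + s k < v q by near: q; exact: cvgr_gt vb _ _.
have vy' : y (sup k) + s (sup k) < v q by near: q; exact: cvgr_gt vb _ _.
rewrite (below_headE _ _ _ sa).
have [xu|xu] := lerP (x k) (u q); first by rewrite below_headE //; split; lra.
by rewrite below_tailE // below_headE ?ltW //; split; lra.
Unshelve. all: by end_near. Qed.

Lemma below_right sup k a b : supported x y s sup n -> (k < n)%N -> 0 <= a ->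
  below x y sup k a b -> exists2 j, (j <= k)%N & b < y j.
Proof.
move=> supp + + H; elim: H => {k a b} [k a b xa by_|k a b ax _ IH] kn a0.
  by exists k.
have [sk1 _ _ _] := supp k kn (le_lt_trans a0 ax).
have [j jk bj] := IH (ltn_trans sk1 kn) a0.
by exists j => //; rewrite (leq_trans jk) // ltnW.
Qed.

(** The square of the chain that decides at [a] is the witness. With the axes exchanged, this puts a
    whole square between the left wall and a point to the right of a down chain. *)
Lemma not_below_above sup k a b : supported x y s sup n -> (k < n)%N ->
  0 <= a -> a < x k + s k -> off_squares x y s n a b ->
  ~ below x y sup k a b -> exists2 j, (j <= k)%N & y j + s j < b.
Proof.
move=> supp; elim/ltn_ind: k => k IH kn a0 ak off nb.
have [xa|ax] := lerP (x k) a.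
  exists k => //; rewrite below_headE // in nb.
  by case: (off k kn); lra.
have [sk1 xE _ _] := supp k kn (le_lt_trans a0 ax).
rewrite below_tailE // in nb.
have [|j jk bj] := IH _ sk1 (ltn_trans sk1 kn) a0 _ off nb.
  by rewrite xE.
by exists j => //; rewrite (leq_trans jk) // ltnW.
Qed.

(* Walking left from [k] to the abscissa [a], the chain descends by less than
   the total side of the squares it passes, hence by less than [x k - a]. *)
Lemma chain_slope sup k a b : supported x y s sup n -> (k < n)%N ->
  0 <= a -> a < x k -> off_squares x y s n a b ->
  ~ below x y sup k a b -> y k - b < x k - a.
Proof.
move=> supp; elim/ltn_ind: k => k IH kn a0 ax off nb.
have [sk1 xE yk _] := supp k kn (le_lt_trans a0 ax).
have sn := ltn_trans sk1 kn.
rewrite below_tailE // in nb.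
have [xa|ax'] := lerP (x (sup k)) a.
  by rewrite below_headE // in nb; case: (off _ sn); lra.
by have := IH _ sk1 sn a0 ax' off nb; lra.
Qed.

End support_chain.

(** * Regions cut off by chains and walls *)

Section enclosure.
Context {R : realType}.
Variables (n : nat) (x y s : nat -> R) (lsup dsup : nat -> nat).
Hypothesis s_gt0 : forall k, (k < n)%N -> 0 < s k.
Hypothesis x_ge0 : forall k, (k < n)%N -> 0 <= x k.
Hypothesis y_ge0 : forall k, (k < n)%N -> 0 <= y k.
Hypothesis lsupP : supported x y s lsup n.
Hypothesis dsupP : supported y x s dsup n.

(* The region cut off, together with the walls, by the left and the down
   chain of [k]. *)
Definition enclosed k : set (R * R) := [set q |
  [/\ q.2 < y k + s k -> below y x dsup k q.2 q.1,
      q.1 < x k + s k -> below x y lsup k q.1 q.2 &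
      q.2 < y k + s k \/ q.1 < x k + s k]].

Let left_of_locally_constant k (p : R * R) : (k < n)%N -> 0 <= p.2 ->
  p.2 < y k + s k -> off_squares x y s k.+1 p.1 p.2 ->
  \forall q \near p, 0 <= q.2 ->
    (below y x dsup k q.2 q.1 <-> below y x dsup k p.2 p.1).
Proof.
move=> kn p0 pk off.
apply: (below_locally_constant s_gt0 y_ge0 (nbhs_filter p) dsupP kn p0 pk).
- exact: off_squares_swap.
- by case: (p) => p1 p2; exact: cvg_snd.
- by case: (p) => p1 p2; exact: cvg_fst.
Qed.

Let under_locally_constant k (p : R * R) : (k < n)%N -> 0 <= p.1 ->
  p.1 < x k + s k -> off_squares x y s k.+1 p.1 p.2 ->
  \forall q \near p, 0 <= q.1 ->
    (below x y lsup k q.1 q.2 <-> below x y lsup k p.1 p.2).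
Proof.
move=> kn p0 pk off.
apply: (below_locally_constant s_gt0 x_ge0 (nbhs_filter p) lsupP kn p0 pk off).
- by case: (p) => p1 p2; exact: cvg_fst.
- by case: (p) => p1 p2; exact: cvg_snd.
Qed.

(** The clauses change only on the lines extending the top and the right side of [k]. A point off
    [k] on such a line is either left of or under [k], where the clause in question holds at the
    head of the chain, or past the other line, where the region is empty nearby. *)
Lemma enclosed_locally_constant k (p : R * R) : (k < n)%N ->
  0 <= p.1 -> 0 <= p.2 -> off_squares x y s k.+1 p.1 p.2 ->
  \forall q \near p, 0 <= q.1 -> 0 <= q.2 -> (enclosed k q <-> enclosed k p).
Proof.
move=> kn p10 p20 off; have sk := s_gt0 kn.
have offk := off k (leqnn _).
have f1 : fst @ p --> p.1 by case: (p) => ? ?; exact: cvg_fst.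
have f2 : snd @ p --> p.2 by case: (p) => ? ?; exact: cvg_snd.
have [p2|p2|p2] := ltgtP p.2 (y k + s k).
- have left_near := left_of_locally_constant kn p20 p2 off.
  have [p1|p1|p1] := ltgtP p.1 (x k + s k).
  + have under_near := under_locally_constant kn p10 p1 off.
    near=> q => q10 q20.
    have q1 : q.1 < x k + s k by near: q; exact: cvgr_lt f1 _ _.
    have q2 : q.2 < y k + s k by near: q; exact: cvgr_lt f2 _ _.
    have left_q : below y x dsup k q.2 q.1 <-> below y x dsup k p.2 p.1.
      by move: q20; near: q.
    have under_q : below x y lsup k q.1 q.2 <-> below x y lsup k p.1 p.2.
      by move: q10; near: q.
    split=> -[lq uq _]; split; [|by move=> _; apply/under_q/uq|by left| |
      by move=> _; apply/under_q/uq|by left]; by move=> _; apply/left_q/lq.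
  + near=> q => q10 q20.
    have q1 : x k + s k < q.1 by near: q; exact: cvgr_gt f1 _ _.
    have q2 : q.2 < y k + s k by near: q; exact: cvgr_lt f2 _ _.
    have left_q : below y x dsup k q.2 q.1 <-> below y x dsup k p.2 p.1.
      by move: q20; near: q.
    split=> -[lq _ _]; split; [|by move=> ?; lra|by left| |
      by move=> ?; lra|by left]; by move=> _; apply/left_q/lq.
  + have p2y : p.2 < y k by case: offk; lra.
    near=> q => q10 q20.
    have q1 : x k < q.1 by near: q; apply: (cvgr_gt _ f1); lra.
    have q2 : q.2 < y k by near: q; exact: cvgr_lt f2 _ _.
    have left_q : below y x dsup k q.2 q.1 <-> below y x dsup k p.2 p.1.
      by move: q20; near: q.
    split=> -[lq _ _]; split; [|by move=> ?; lra|by left; lra| | |left; lra].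
    * by move=> _; apply/left_q/lq; lra.
    * by move=> _; apply/left_q/lq; lra.
    * by move=> _; rewrite below_headE // ltW.
- have [p1|p1|p1] := ltgtP p.1 (x k + s k).
  + have under_near := under_locally_constant kn p10 p1 off.
    near=> q => q10 q20.
    have q1 : q.1 < x k + s k by near: q; exact: cvgr_lt f1 _ _.
    have q2 : y k + s k < q.2 by near: q; exact: cvgr_gt f2 _ _.
    have under_q : below x y lsup k q.1 q.2 <-> below x y lsup k p.1 p.2.
      by move: q10; near: q.
    split=> -[_ uq _]; split; [by move=> ?; lra| |by right|
      by move=> ?; lra| |by right]; by move=> _; apply/under_q/uq.
  + near=> q => q10 q20.
    have q1 : x k + s k < q.1 by near: q; exact: cvgr_gt f1 _ _.
    have q2 : y k + s k < q.2 by near: q; exact: cvgr_gt f2 _ _.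
    by split=> -[_ _ []]; lra.
  + near=> q => q10 q20.
    have q1 : x k < q.1 by near: q; apply: (cvgr_gt _ f1); lra.
    have q2 : y k + s k < q.2 by near: q; exact: cvgr_gt f2 _ _.
    split=> -[_ uq []]; try lra.
    by move=> /uq; rewrite below_headE ?ltW//; lra.
- have [p1|p1|p1] := ltgtP p.1 (x k + s k).
  + have p1x : p.1 < x k by case: offk; lra.
    have under_near := under_locally_constant kn p10 p1 off.
    near=> q => q10 q20.
    have q1 : q.1 < x k by near: q; exact: cvgr_lt f1 _ _.
    have q2 : y k < q.2 by near: q; apply: (cvgr_gt _ f2); lra.
    have under_q : below x y lsup k q.1 q.2 <-> below x y lsup k p.1 p.2.
      by move: q10; near: q.
    split=> -[_ uq _]; split; [by move=> ?; lra| |by right; lra| | |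
      by right; lra].
    * by move=> _; apply/under_q/uq; lra.
    * by move=> _; rewrite below_headE // ltW.
    * by move=> _; apply/under_q/uq; lra.
  + near=> q => q10 q20.
    have q1 : x k + s k < q.1 by near: q; exact: cvgr_gt f1 _ _.
    have q2 : y k < q.2 by near: q; apply: (cvgr_gt _ f2); lra.
    split=> -[lq _ []]; try lra.
    by move=> /lq; rewrite below_headE ?ltW//; lra.
  + by case: offk; lra.
Unshelve. all: by end_near. Qed.

(* When [k] touches the right wall, this is the region cut off by the down
   chain of [k] and that wall. *)
Definition east_of k : set (R * R) :=
  [set q | q.2 < y k + s k /\ ~ below y x dsup k q.2 q.1].

(** On the top line of [k], the bound [p.1 <= x k + s k] leaves only points to the left of [k], near
    which the region is empty. *)
Lemma east_of_locally_constant k (p : R * R) : (k < n)%N ->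
  0 <= p.1 <= x k + s k -> 0 <= p.2 -> off_squares x y s k.+1 p.1 p.2 ->
  \forall q \near p, 0 <= q.2 -> (east_of k q <-> east_of k p).
Proof.
move=> kn /andP[p10 pW] p20 off; have sk := s_gt0 kn.
have offk := off k (leqnn _).
have f1 : fst @ p --> p.1 by case: (p) => ? ?; exact: cvg_fst.
have f2 : snd @ p --> p.2 by case: (p) => ? ?; exact: cvg_snd.
have [p2|p2|p2] := ltgtP p.2 (y k + s k).
- have left_near := left_of_locally_constant kn p20 p2 off.
  near=> q => q20.
  have q2 : q.2 < y k + s k by near: q; exact: cvgr_lt f2 _ _.
  have left_q : below y x dsup k q.2 q.1 <-> below y x dsup k p.2 p.1.
    by move: q20; near: q.
  by split=> -[_ /left_q lq]; split.
- near=> q => q20.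
  have q2 : y k + s k < q.2 by near: q; exact: cvgr_gt f2 _ _.
  by split=> -[]; lra.
- have p1x : p.1 < x k by case: offk; lra.
  near=> q => q20.
  have q1 : q.1 < x k by near: q; exact: cvgr_lt f1 _ _.
  have q2 : y k < q.2 by near: q; apply: (cvgr_gt _ f2); lra.
  split=> -[]; last lra.
  by move=> _; rewrite below_headE ?ltW.
Unshelve. all: by end_near. Qed.

Lemma enclosed_bound k (q : R * R) : (k < n)%N -> 0 <= q.1 -> enclosed k q ->
  exists2 j, (j <= k)%N & q.2 < y j + s j.
Proof.
move=> kn q10 [_ under [qk|/under /(below_right lsupP kn q10) [j jk qj]]].
  by exists k.
exists j => //; have := s_gt0 (leq_ltn_trans jk kn); lra.
Qed.

End enclosure.

(** * Separation of squares *)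

Section squares.
Context {R : realType}.
Implicit Types (p q : R * R) (a b : R).

Lemma open_intervals_meet (a b a' b' : R) :
  a < b -> a' < b' -> a < b' -> a' < b -> exists t, a < t < b /\ a' < t < b'.
Proof.
move=> ab ab' h h'.
have [aa'|aa'] := leP a a'; have [bb'|bb'] := leP b b'.
- by exists ((a' + b) / 2); lra.
- by exists ((a' + b') / 2); lra.
- by exists ((a + b) / 2); lra.
- by exists ((a + b') / 2); lra.
Qed.

Lemma le_or_lt a b : a <= b \/ b < a.
Proof. by case: leP; [left|right]. Qed.

Lemma sq_int_disjointP p a q b : 0 < a -> 0 < b ->
  sq_int p a `&` sq_int q b = set0 <->
  [\/ p.1 + a <= q.1, q.1 + b <= p.1, p.2 + a <= q.2 | q.2 + b <= p.2].
Proof.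
move=> a0 b0; split=> [disj|sep]; last first.
  rewrite -subset0 => t [[/andP[? ?] /andP[? ?]] [/andP[? ?] /andP[? ?]]].
  by case: sep; lra.
have [|h1] := leP (p.1 + a) q.1; first by constructor 1.
have [|h2] := leP (q.1 + b) p.1; first by constructor 2.
have [|h3] := leP (p.2 + a) q.2; first by constructor 3.
have [|h4] := leP (q.2 + b) p.2; first by constructor 4.
have [||||t1 [t1p t1q]] := @open_intervals_meet p.1 (p.1 + a) q.1 (q.1 + b);
  try lra.
have [||||t2 [t2p t2q]] := @open_intervals_meet p.2 (p.2 + a) q.2 (q.2 + b);
  try lra.
have : set0 (t1, t2) by rewrite -disj.
by [].
Qed.

End squares.

(** * Supports in a bottom-left packing *)

Section packing.
Context {R : realType}.
Variables (W : R) (n : nat) (s : nat -> R) (pos : nat -> R * R).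
Hypothesis s_gt0 : forall k, (k < n)%N -> 0 < s k.
Hypothesis BL : BL_packing W n s pos.
Let x j := (pos j).1.
Let y j := (pos j).2.

Definition clear_of k (p : R * R) a := forall j, (j < k)%N ->
  [\/ p.1 + a <= x j, x j + s j <= p.1, p.2 + a <= y j | y j + s j <= p.2].

Lemma feasibleP k p : (k < n)%N -> feasible W s pos k p <->
  [/\ 0 <= p.1, p.1 + s k <= W, 0 <= p.2 & clear_of k p (s k)].
Proof.
move=> kn; split=> -[? ? ? disj]; split=> // j jk.
  exact/sq_int_disjointP/disj/jk/s_gt0/(ltn_trans jk kn)/s_gt0.
by apply/sq_int_disjointP/disj => //; apply/s_gt0 => //; apply: ltn_trans jk kn.
Qed.

Lemma BL_feasible k : (k < n)%N ->
  [/\ 0 <= x k, x k + s k <= W, 0 <= y k & clear_of k (pos k) (s k)].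
Proof. by move=> kn; have [/(feasibleP _ kn)] := BL kn. Qed.

Lemma BL_lowest k p : (k < n)%N -> 0 <= p.1 -> p.1 + s k <= W -> 0 <= p.2 ->
  clear_of k p (s k) -> y k < p.2 \/ y k = p.2 /\ x k <= p.1.
Proof. by move=> kn *; have [_] := BL kn; apply; apply/feasibleP. Qed.

Lemma squares_apart j k : (j < n)%N -> (k < n)%N -> j <> k ->
  [\/ x k + s k <= x j, x j + s j <= x k, y k + s k <= y j | y j + s j <= y k].
Proof.
move=> jn kn jk; have [lt_jk|lt_kj|//] := ltngtP j k.
  by have [_ _ _ /(_ j lt_jk)] := BL_feasible kn.
have [_ _ _ /(_ k lt_kj)] := BL_feasible jn.
by case; [constructor 2|constructor 1|constructor 4|constructor 3].
Qed.

(** If nothing touched [k] on the left, sliding it left would give a feasible position at the same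
    height with smaller abscissa. *)
Lemma left_support k : (k < n)%N -> 0 < x k ->
  exists j, [/\ (j < k)%N, x j + s j = x k, y k < y j + s j & y j < y k + s k].
Proof.
move=> kn x0; have [xk xkW yk clear] := BL_feasible kn; have sk := s_gt0 kn.
pose P j := [/\ y k < y j + s j, y j < y k + s k & x j + s j <= x k].
(* [t] is where [k], slid left, would stop; the default [0] is the wall. *)
have [t [t0 tub tE]] := bounded_max P (fun j => x j + s j) 0 k.
have [[jt0|[j [jk [? ? jx] jt]]] tx] : (t = 0 \/ exists j,
    [/\ (j < k)%N, P j & t = x j + s j]) /\ t = x k.
- split => //; apply: contrapT => ntx.
  have {ntx} tx : t < x k.
    rewrite lt_neqAle; apply/andP; split; first exact/eqP.
    by case: tE => [->|[j [_ [_ _ ?] ->]]] //; exact: ltW.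
  case: (@BL_lowest k (t, y k)) => //=; try lra.
  move=> j jk; have sj := s_gt0 (ltn_trans jk kn).
  case: (clear j jk); rewrite -/(x k) -/(y k) => c;
    [by constructor 1 => /=; lra| |by constructor 3|by constructor 4].
  have [h|h] := leP (y k + s k) (y j); first by constructor 3.
  have [h'|h'] := leP (y j + s j) (y k); first by constructor 4.
  by constructor 2; apply: tub.
- by lra.
- by exists j; split => //; lra.
Qed.

(** The same argument with [k] slid down, the floor being the default. *)
Lemma down_support k : (k < n)%N -> 0 < y k ->
  exists j, [/\ (j < k)%N, y j + s j = y k, x k < x j + s j & x j < x k + s k].
Proof.
move=> kn y0; have [xk xkW yk clear] := BL_feasible kn; have sk := s_gt0 kn.
pose P j := [/\ x k < x j + s j, x j < x k + s k & y j + s j <= y k].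
have [t [t0 tub tE]] := bounded_max P (fun j => y j + s j) 0 k.
have [[jt0|[j [jk [? ? jx] jt]]] ty] : (t = 0 \/ exists j,
    [/\ (j < k)%N, P j & t = y j + s j]) /\ t = y k.
- split => //; apply: contrapT => nty.
  have {nty} ty : t < y k.
    rewrite lt_neqAle; apply/andP; split; first exact/eqP.
    by case: tE => [->|[j [_ [_ _ ?] ->]]] //; exact: ltW.
  case: (@BL_lowest k (x k, t)) => //=; try lra.
  move=> j jk; have sj := s_gt0 (ltn_trans jk kn).
  case: (clear j jk); rewrite -/(x k) -/(y k) => c;
    [by constructor 1|by constructor 2|by constructor 3 => /=; lra|].
  have [h|h] := leP (x k + s k) (x j); first by constructor 1.
  have [h'|h'] := leP (x j + s j) (x k); first by constructor 2.
  by constructor 4; apply: tub.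
- by lra.
- by exists j; split => //; lra.
Qed.

Lemma supports_exist : exists lsup dsup,
  supported x y s lsup n /\ supported y x s dsup n.
Proof.
have [lsup lsupP] : {lsup : nat -> nat & forall k, (k < n)%N -> 0 < x k ->
  [/\ (lsup k < k)%N, x (lsup k) + s (lsup k) = x k,
    y k < y (lsup k) + s (lsup k) & y (lsup k) < y k + s k]}.
  apply: (@choice _ _ (fun k j => (k < n)%N -> 0 < x k ->
    [/\ (j < k)%N, x j + s j = x k, y k < y j + s j & y j < y k + s k])) => k.
  have [[kn xk]|nk] := pselect ((k < n)%N /\ 0 < x k).
    by have [j ?] := left_support kn xk; exists j.
  by exists 0%N => kn xk; exfalso; apply: nk.
have [dsup dsupP] : {dsup : nat -> nat & forall k, (k < n)%N -> 0 < y k ->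
  [/\ (dsup k < k)%N, y (dsup k) + s (dsup k) = y k,
    x k < x (dsup k) + s (dsup k) & x (dsup k) < x k + s k]}.
  apply: (@choice _ _ (fun k j => (k < n)%N -> 0 < y k ->
    [/\ (j < k)%N, y j + s j = y k, x k < x j + s j & x j < x k + s k])) => k.
  have [[kn yk]|nk] := pselect ((k < n)%N /\ 0 < y k).
    by have [j ?] := down_support kn yk; exists j.
  by exists 0%N => kn yk; exfalso; apply: nk.
by exists lsup, dsup.
Qed.

End packing.

(** * Pieces and the segments inside them *)

Section pieces.
Context {R : realType}.
Variables (W : R) (s : nat -> R) (pos : nat -> R * R).
Let x j := (pos j).1.
Let y j := (pos j).2.
Implicit Types (A U : set (R * R)) (q : R * R).

Lemma off_squaresP m q : off_squares x y s m q.1 q.2 <->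
  forall j, (j < m)%N -> ~ sq (pos j) (s j) q.
Proof.
split=> [off j jm [/andP[? ?] /andP[? ?]]|off j jm].
  by case: (off j jm); rewrite /x /y; lra.
have [|h1] := ltP q.1 (x j); first by constructor 1.
have [|h2] := ltP (x j + s j) q.1; first by constructor 2.
have [|h3] := ltP q.2 (y j); first by constructor 3.
have [|h4] := ltP (y j + s j) q.2; first by constructor 4.
by case: (off j jm); split; apply/andP.
Qed.

Lemma sq_sub_removed m j : (j < m)%N ->
  sq (pos j) (s j) `<=` removed W s pos m.
Proof.
elim: m => // m IH; rewrite ltnS leq_eqVlt => /orP[/eqP ->|jm] q qj /=.
  by left; right.
by left; left; exact: IH qj.
Qed.

Lemma removed_subset m m' : (m <= m')%N ->
  removed W s pos m `<=` removed W s pos m'.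
Proof.
move=> /subnK <-; elim: (m' - m)%N => // d IH.
by rewrite addSn => q /IH; left; left.
Qed.

(** By induction on the stage: a connected set that avoids the squares and all that was removed
    before lies inside any component it meets, so it is removed as a whole or not at all. *)
Lemma connected_removed m A : connected A -> A `<=` strip W ->
  (forall q, A q -> off_squares x y s m q.1 q.2) ->
  A `<=` removed W s pos m \/ A `&` removed W s pos m = set0.
Proof.
move=> cA AW; elim: m => [|m IH] off; first by right; rewrite setI0.
have [|sub|disj] := IH.
- by move=> q /off; exact: off_squares_leq.
- by left => q /sub; left; left.
have sqm : A `&` sq (pos m) (s m) = set0.
  rewrite -subset0 => q [/off/off_squaresP/(_ m)]; exact.
have [[q [Aq rq]]|none] := pselect (A `&` removed W s pos m.+1 !=set0);
  last by right; rewrite -subset0 => q Aq; apply: none; exists q.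
left; case: rq => [[rq|sq_]|].
- by have : set0 q by rewrite -disj.
- by have : set0 q by rewrite -sqm.
(* The first stage removes no pieces; at later stages [C] is the piece that [A] meets. *)
case: m {IH off} disj {sqm} => [_ []|m disj [C [[z [Az CE]] bC] Cq]] r Ar.
right; exists C; first by split => //; exists z.
rewrite CE in Cq *; apply: (connected_component_trans Cq).
apply: (connected_component_max Aq _ cA Ar) => t At; split; first exact: AW.
by move=> rt; have : set0 t by rewrite -disj.
Qed.

Variables (i : nat) (U : set (R * R)).
Hypothesis Upiece : pieces W s pos i U.

Lemma piece_sub_strip : U `<=` strip W.
Proof.
by case: Upiece => -[z [_ ->]] _ q /connected_component_sub [].
Qed.

Lemma piece_not_removed q : U q -> ~ removed W s pos i q.
Proof. by case: Upiece => -[z [_ ->]] _ /connected_component_sub []. Qed.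

Lemma piece_off_squares q : U q -> off_squares x y s i q.1 q.2.
Proof.
move=> Uq; apply/off_squaresP => j ji qj.
exact/(piece_not_removed Uq)/(sq_sub_removed ji).
Qed.

Lemma piece_connected : connected U.
Proof. by case: Upiece => -[z [_ ->]] _; exact: component_connected. Qed.

(** Avoiding the squares suffices: a common point with [U] shows that [A] is not removed, so [A]
    misses the earlier pieces as well. *)
Lemma piece_absorbs A q : connected A -> A `<=` strip W ->
  (forall q, A q -> off_squares x y s i q.1 q.2) -> A q -> U q -> A `<=` U.
Proof.
move=> cA AW off Aq Uq.
have [sub|disj] := connected_removed cA AW off.
  by case: (piece_not_removed Uq); exact: sub.
case: Upiece => -[z [Az UE]] _; rewrite UE in Uq *.
move=> r Ar; apply: (connected_component_trans Uq).
apply: (connected_component_max Aq _ cA Ar) => t At; split; first exact: AW.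
by move=> rt; have : set0 t by rewrite -disj.
Qed.

Lemma vertical_segment_in_piece (a b c : R) : b <= c -> U (a, b) ->
  (forall t, b <= t <= c -> off_squares x y s i a t) -> U (a, c).
Proof.
move=> bc Uab off.
have cont : {within `[b, c], continuous (fun t => (a, t))}.
  apply: continuous_subspaceT => t.
  by apply: (@cvg_pair _ _ _ _ (nbhs a) (nbhs t));
    [exact: cvg_cst|exact: cvg_id].
have cA : connected ((fun t => (a, t)) @` `[b, c]).
  by apply: connected_continuous_connected => //; exact: segment_connected.
have [/= Wa b0] := piece_sub_strip Uab.
apply: (piece_absorbs cA _ _ _ Uab).
- by move=> _ [t /= + <-]; rewrite in_itv /= => tbc; split => //=; lra.
- by move=> _ [t /= + <-]; rewrite in_itv /= => tbc; exact: off.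
- by exists b => //=; rewrite in_itv /= lexx.
- by exists c => //=; rewrite in_itv /= lexx bc.
Qed.

Lemma horizontal_segment_in_piece (a b c : R) : a <= c <= W -> U (a, b) ->
  (forall t, a <= t <= c -> off_squares x y s i t b) -> U (c, b).
Proof.
move=> acW Uab off.
have cont : {within `[a, c], continuous (fun t => (t, b))}.
  apply: continuous_subspaceT => t.
  by apply: (@cvg_pair _ _ _ _ (nbhs t) (nbhs b));
    [exact: cvg_id|exact: cvg_cst].
have cA : connected ((fun t => (t, b)) @` `[a, c]).
  by apply: connected_continuous_connected => //; exact: segment_connected.
have [/= Wa b0] := piece_sub_strip Uab.
apply: (piece_absorbs cA _ _ _ Uab).
- by move=> _ [t /= + <-]; rewrite in_itv /= => tbc; split => //=; lra.
- by move=> _ [t /= + <-]; rewrite in_itv /= => tbc; exact: off.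
- by exists a => //=; rewrite in_itv /= lexx; lra.
- by exists c => //=; rewrite in_itv /= lexx; lra.
Qed.

Lemma closure_in_piece (c : R * R) :
  (forall e : R, 0 < e ->
    exists q, [/\ U q, `|c.1 - q.1| < e & `|c.2 - q.2| < e]) ->
  closure U c.
Proof.
move=> near_c B /nbhs_ballP[e /= e0 eB].
by have [q [Uq q1 q2]] := near_c e e0; exists q; split => //; exact: eB.
Qed.

Lemma vertical_hit_adjacent (a b c : R) : b < c -> U (a, b) ->
  (forall t, b <= t < c -> off_squares x y s i a t) -> closure U (a, c).
Proof.
move=> bc Uab off; apply: closure_in_piece => e e0.
have [||||t [tbc tce]] := @open_intervals_meet _ b c (c - e) c; try lra.
exists (a, t); rewrite /= subrr normr0 ger0_norm; last lra.
split => //; last lra.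
apply: (vertical_segment_in_piece _ Uab); first lra.
by move=> u ut; apply: off; lra.
Qed.

Lemma horizontal_hit_adjacent (a b c : R) : a < c <= W -> U (a, b) ->
  (forall t, a <= t < c -> off_squares x y s i t b) -> closure U (c, b).
Proof.
move=> acW Uab off; apply: closure_in_piece => e e0.
have [||||t [tbc tce]] := @open_intervals_meet _ a c (c - e) c; try lra.
exists (t, b); rewrite /= subrr normr0 ger0_norm; last lra.
split => //; last lra.
apply: (horizontal_segment_in_piece _ Uab); first lra.
by move=> u ut; apply: off; lra.
Qed.

End pieces.

(** * Covering the points of a left or middle piece in general position *)

Section local_cover.
Context {R : realType}.
Variables (W : R) (i : nat) (s : nat -> R) (pos : nat -> R * R).
Variable U : set (R * R).
Hypothesis s_gt0 : forall k, (k < i)%N -> 0 < s k.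
Hypothesis BL : BL_packing W i s pos.
Hypothesis Upiece : pieces W s pos i U.
Let x j := (pos j).1.
Let y j := (pos j).2.

Variables lsup dsup : nat -> nat.
Hypothesis lsupP : supported x y s lsup i.
Hypothesis dsupP : supported y x s dsup i.

Let x_ge0 k : (k < i)%N -> 0 <= x k.
Proof. by move=> /(BL_feasible s_gt0 BL) []. Qed.

Let y_ge0 k : (k < i)%N -> 0 <= y k.
Proof. by move=> /(BL_feasible s_gt0 BL) []. Qed.

Let right_le_W k : (k < i)%N -> x k + s k <= W.
Proof. by move=> /(BL_feasible s_gt0 BL) []. Qed.

(* A component enclosed by the chains of a square placed before the last one
   is a piece of an earlier stage. *)
Lemma not_enclosed k q : (k.+1 < i)%N -> U q ->
  ~ enclosed x y s lsup dsup k q.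
Proof.
move=> ki Uq encl; have kltn : (k < i)%N := ltnW ki.
have [/= Wq q20] := piece_sub_strip Upiece Uq.
have nrq := piece_not_removed Upiece Uq.
pose A := strip W `\` removed W s pos k.+1.
have Aq : A q by split => // /(removed_subset (ltnW ki)).
pose C := connected_component A q.
have CW : C `<=` strip W by move=> r /connected_component_sub [].
have Coff r : C r -> off_squares x y s k.+1 r.1 r.2.
  move=> /connected_component_sub [_ nr]; apply/off_squaresP => j jk rj.
  by apply: nr; exact: sq_sub_removed rj.
have Cencl : C `<=` enclosed x y s lsup dsup k.
  apply: connected_locally_constant (connected_component_refl Aq) encl.
    exact: component_connected.
  move=> r Cr.
  have [/= Wr r20] := CW r Cr.
  have {}Wr : 0 <= r.1 by lra.
  have lc := enclosed_locally_constant s_gt0 x_ge0 y_ge0 lsupP dsupP kltn Wr r20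
    (Coff r Cr).
  apply: filterS lc => t + /CW [/= Wt t20]; apply => //; lra.
(* Starting the maximum at [W] makes [M] bound both coordinates. *)
have [M [WM Mub _]] := bounded_max (fun=> True) (fun j => y j + s j) W i.
(* The component is a piece of stage [k.+1], hence removed from stage [k.+2] on, and [k.+2 <= i]. *)
apply: nrq; apply: (removed_subset ki); right; exists C.
  split; first by exists q.
  exists M => r Cr; have [/= Wr r20] := CW r Cr.
  have [|j jk rj] := enclosed_bound s_gt0 lsupP kltn _ (Cencl r Cr); first lra.
  have := Mub j (leq_ltn_trans jk kltn) Logic.I.
  by rewrite !ger0_norm; lra.
exact: connected_component_refl.
Qed.

(** Without a square above, the whole upward ray would lie in the bounded set [U]. *)
Lemma first_square_above a b : U (a, b) -> exists k,
  [/\ (k < i)%N, x k <= a <= x k + s k, b < y k &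
    forall j, (j < i)%N -> x j <= a <= x j + s j -> b < y j -> y k <= y j].
Proof.
move=> Uab.
pose P j := x j <= a <= x j + s j /\ b < y j.
have [[j0 [j0i Pj0]]|none] := pselect (exists j, (j < i)%N /\ P j).
  have [k [ki [Pk1 Pk2] kmax]] := exists_max (fun j => - y j) j0i Pj0.
  exists k; split => // j ji j1 j2.
  by have := kmax j ji (conj j1 j2); lra.
exfalso; have [_ [M Mub]] := Upiece.
have off t : b <= t -> off_squares x y s i a t.
  move=> bt j ji; have := piece_off_squares Upiece Uab ji => /=.
  case=> h; [by constructor 1|by constructor 2| |constructor 4; lra].
  have [|h1] := ltP a (x j); first by constructor 1.
  have [|h2] := ltP (x j + s j) a; first by constructor 2.
  by exfalso; apply: none; exists j; split => //; split => //; lra.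
have [_] := Mub _ Uab; rewrite ler_norml /= => bM.
have UM : U (a, M + 1).
  apply: (vertical_segment_in_piece Upiece _ Uab); first lra.
  by move=> t /andP[bt _]; exact: off.
by have [_] := Mub _ UM; rewrite ler_norml /=; lra.
Qed.

Lemma column_off a b k : U (a, b) ->
  (forall j, (j < i)%N -> x j <= a <= x j + s j -> b < y j -> y k <= y j) ->
  forall t, b <= t < y k -> off_squares x y s i a t.
Proof.
move=> Uab kfirst t bt j ji.
have := piece_off_squares Upiece Uab ji => /=.
case=> h; [by constructor 1|by constructor 2| |constructor 4; lra].
have [|h1] := ltP a (x j); first by constructor 1.
have [|h2] := ltP (x j + s j) a; first by constructor 2.
by constructor 3; have := kfirst j ji; rewrite h1 h2 => /(_ isT h); lra.
Qed.

(** The first square above [(W, b)] touches the right wall, and [U] stays to the right of its down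
    chain. Each point of [U] thus has a whole square between itself and the left wall, which keeps
    [U] away from that wall. *)
Lemma right_wall_not_left b : U (W, b) -> ~ left_piece W U.
Proof.
move=> UWb [[u1 u2] [clu [/= u10 u20]]].
have [k [ki kW bk _]] := first_square_above UWb.
have kW' : x k + s k = W by have := right_le_W ki; lra.
have [/= W0 b0] := piece_sub_strip Upiece UWb.
have east : U `<=` east_of x y s dsup k.
  apply: connected_locally_constant UWb _.
  - exact: piece_connected Upiece.
  - move=> r Ur; have [/= Wr r20] := piece_sub_strip Upiece Ur.
    have rW : 0 <= r.1 <= x k + s k by lra.
    have lc := east_of_locally_constant s_gt0 y_ge0 dsupP ki rW r20
      (off_squares_leq ki (piece_off_squares Upiece Ur)).
    by apply: filterS lc => t + /(piece_sub_strip Upiece) [_ t20]; exact.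
  split => /=; first by have := s_gt0 ki; lra.
  move=> /(below_right dsupP ki b0) [j jk].
  by have := right_le_W (leq_ltn_trans jk ki);
     have := s_gt0 (leq_ltn_trans jk ki); lra.
(* The smallest side is a uniform lower bound for the distance to the left wall. *)
have [m [mi _ mmin]] := exists_max (fun j => - s j) ki Logic.I.
have [q [Uq /= [uq1 uq2]]] := clu _ (nbhsx_ballx (u1, u2) _ (s_gt0 mi)).
have [/= Wq q20] := piece_sub_strip Upiece Uq.
have [qk nleft] := east q Uq.
have [j jk jq] := not_below_above dsupP ki q20 qk
  (off_squares_swap (piece_off_squares Upiece Uq)) nleft.
have ji := leq_ltn_trans jk ki.
have := mmin j ji Logic.I; have := x_ge0 ji.
by move: uq1; rewrite /ball /= u10 sub0r normrN ger0_norm; lra.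
Qed.

Hypothesis left_or_middle : left_piece W U \/ middle_piece W U.

Lemma not_right_wall b : ~ U (W, b).
Proof.
move=> UWb; case: left_or_middle => [|[_ nr]].
  exact: right_wall_not_left UWb.
apply: nr; exists (W, b); split; first exact: subset_closure.
by have [/= _ ?] := piece_sub_strip Upiece UWb.
Qed.

(** A free ray would reach the right wall inside [U], which is excluded for left and middle
    pieces. *)
Lemma first_square_right a b : U (a, b) -> exists k,
  [/\ (k < i)%N, a < x k, y k <= b <= y k + s k,
    adjacent_to (sq (pos k) (s k)) U &
    forall j, (j < i)%N -> a < x j -> y j <= b <= y j + s j -> x k <= x j].
Proof.
move=> Uab; have [/= aW b0] := piece_sub_strip Upiece Uab.
pose P j := a < x j /\ y j <= b <= y j + s j.
have off0 := piece_off_squares Upiece Uab.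
have [[j0 [j0i Pj0]]|none] := pselect (exists j, (j < i)%N /\ P j).
  have [k [ki [Pk1 Pk2] kmax]] := exists_max (fun j => - x j) j0i Pj0.
  have kfirst j : (j < i)%N -> a < x j -> y j <= b <= y j + s j -> x k <= x j.
    by move=> ji j1 j2; have := kmax j ji (conj j1 j2); lra.
  have xW : x k <= W by have := right_le_W ki; have := s_gt0 ki; lra.
  exists k; split => //; exists (x k, b); split; last first.
    split; rewrite /= -?/(x k) -?/(y k) //.
    by have := s_gt0 ki; rewrite lexx; lra.
  apply: (horizontal_hit_adjacent Upiece _ Uab); first by rewrite Pk1.
  move=> t at_ j ji; case: (off0 j ji) => /= h;
    [|constructor 2; lra|by constructor 3|by constructor 4].
  have [|h1] := ltP b (y j); first by constructor 3.
  have [|h2] := ltP (y j + s j) b; first by constructor 4.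
  by constructor 1; have := kfirst j ji h; rewrite h1 h2 => /(_ isT); lra.
exfalso; apply: (@not_right_wall b).
apply: (horizontal_segment_in_piece Upiece _ Uab); first lra.
move=> t at_ j ji; case: (off0 j ji) => /= h;
  [|constructor 2; lra|by constructor 3|by constructor 4].
have [|h1] := ltP b (y j); first by constructor 3.
have [|h2] := ltP (y j + s j) b; first by constructor 4.
by exfalso; apply: none; exists j; split => //; split => //; rewrite h1 h2.
Qed.

(* [p] lies under the left chain of [k]; were this chain to pass above [p], the
   down chain of [k], which cannot cross the empty column above [p], would
   enclose [p] together with it. *)
Lemma left_chain_under p c k : U p -> (c < i)%N ->
  x c <= p.1 < x c + s c ->
  (forall j, (j < i)%N -> x j <= p.1 <= x j + s j -> p.2 < y j -> y c <= y j) ->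
  (k.+1 < i)%N -> p.1 < x k -> p.2 < y k + s k ->
  y k < y c \/ (k < c)%N /\ y k < y c + s c ->
  y k - p.2 < x k - p.1.
Proof.
move=> Up ci pc cfirst ki pk pk2 k_low; have kltn : (k < i)%N := ltnW ki.
have [/= Wp p20] := piece_sub_strip Upiece Up.
have p10 : 0 <= p.1 by lra.
have off := piece_off_squares Upiece Up.
apply: (chain_slope lsupP kltn p10 pk off) => under.
apply: (not_enclosed ki Up); split => [_|_|]; [|exact: under|by left].
elim/ltn_ind: k {ki under} kltn pk pk2 k_low => k IH ki pk pk2 k_low.
have [yp|py] := leP (y k) p.2; first exact: below_head.
apply: below_tail => //.
have [dk dE xd dx] := dsupP ki (le_lt_trans p20 py).
have di := ltn_trans dk ki; have sd := s_gt0 di; have sk := s_gt0 ki.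
have yd : y (dsup k) < y k by lra.
have [xp|px] := leP (x (dsup k)) p.1; last first.
  apply: IH => //; first by rewrite dE.
  by case: k_low => [|[kc]];
    [left; lra|right; split; [exact: ltn_trans kc|lra]].
(* Now [dsup k] crosses the column above [p], so it is no lower than [c]. This refutes the first
   alternative for [k]; in the second, [dsup k] would overlap [c]. *)
have pd : p.2 < y (dsup k) by case: (off _ di); lra.
have := cfirst _ di; rewrite xp => /(_ _ pd) H; have {}H : y c <= y (dsup k).
  by apply: H => /=; lra.
case: k_low => [|[kc kyc]]; first lra.
have /eqP dc : dsup k != c by rewrite neq_ltn (ltn_trans dk kc).
by case: (squares_apart s_gt0 BL di ci dc); rewrite -/(x _) -/(y _); lra.
Qed.

(** Two copies below serve a square seen above the point; the left and lower left copies serve a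
    square seen to the right. A square may play both roles for different points, whence four. *)
Definition shifts (a : R) : seq (R * R) :=
  [:: (0, - a); (0, - (2 * a)); (- a, 0); (- a, - a)].

Definition in_copy j p := exists2 d, d \in shifts (s j) &
  sq (x j + d.1, y j + d.2) (s j) p.

Lemma in_copy_below j p : x j <= p.1 <= x j + s j ->
  y j - 2 * s j <= p.2 <= y j -> in_copy j p.
Proof.
move=> p1 p2; have [h|h] := leP (y j - s j) p.2.
  exists (0, - s j); first by rewrite !inE eqxx.
  by split; apply/andP; split => /=; lra.
exists (0, - (2 * s j)); first by rewrite !inE eqxx ?orbT.
by split; apply/andP; split => /=; lra.
Qed.

Lemma in_copy_left j p : x j - s j <= p.1 <= x j ->
  y j - s j <= p.2 <= y j + s j -> in_copy j p.
Proof.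
move=> p1 p2; have [h|h] := leP (y j) p.2.
  exists (- s j, 0); first by rewrite !inE eqxx ?orbT.
  by split; apply/andP; split => /=; lra.
exists (- s j, - s j); first by rewrite !inE eqxx ?orbT.
by split; apply/andP; split => /=; lra.
Qed.

(** Genericity makes the square above [p] extend strictly to the right of the column. *)
Lemma generic_point_covered p : U p ->
  (forall j, (j < i)%N -> p.1 <> x j + s j) ->
  exists j, [/\ (j < i)%N, adjacent_to (sq (pos j) (s j)) U & in_copy j p].
Proof.
case: p => p1 p2 Up generic; have [/= Wp p20] := piece_sub_strip Upiece Up.
have [c [ci pc p2c cfirst]] := first_square_above Up.
have pc' : x c <= p1 < x c + s c.
  by have /eqP := generic c ci; rewrite /= neq_lt; lra.
have sc := s_gt0 ci.
have column t : p2 <= t < y c -> U (p1, t).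
  move=> pt; apply: (vertical_segment_in_piece Upiece _ Up); first lra.
  by move=> u ut; apply: (column_off Up cfirst); lra.
have cadj : adjacent_to (sq (pos c) (s c)) U.
  exists (p1, y c); split.
    exact: (vertical_hit_adjacent Upiece p2c Up (column_off Up cfirst)).
  by split; rewrite /= -/(x c) -/(y c); [exact: pc|apply/andP; lra].
have [near_c|far_c] := leP (y c) (p2 + 2 * s c).
  by exists c; split => //; apply: in_copy_below => /=; lra.
apply: contrapT => none.
pose visible h v := [/\ (v < i)%N, p1 < x v, y v <= h <= y v + s v,
  adjacent_to (sq (pos v) (s v)) U & forall j, (j < i)%N -> p1 < x j ->
    y j <= h <= y j + s j -> x v <= x j].
(* Both heights lie in the column, as [p2 + 2 * s c < y c]; their distance [s c] forces a square
   seen from both to have side at least [s c]. *)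
have [|v1 vis1] := @first_square_right p1 (p2 + s c).
  by apply: column; lra.
have [|v2 vis2] := @first_square_right p1 (p2 + 2 * s c).
  by apply: column; lra.
(* A square other than the last is wanted because [left_chain_under] requires [k.+1 < i]. *)
have [h [v [vis vi hlow hc]]] : exists h v, [/\ visible h v, (v.+1 < i)%N,
    p2 + s c <= h & h < y c].
  have [?|n1] := ltnP v1.+1 i; first by exists (p2 + s c), v1; split => //; lra.
  have [?|n2] := ltnP v2.+1 i.
    by exists (p2 + 2 * s c), v2; split => //; lra.
  (* Both rays hit the last square, which is then at least as large as [c] and
     lower: [c] would have been placed there. *)
  case: vis1 vis2 => v1i v1x v1y _ _ [v2i v2x v2y _ _].
  have v12 : v2 = v1.
    by apply/eqP; rewrite eqn_leq -ltnS (leq_trans v2i n1) -ltnS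
      (leq_trans v1i n2).
  have cv : (c < v1)%N.
    rewrite ltn_neqAle -ltnS (leq_trans ci n1) andbT; apply/eqP => cE.
    by move: v1x; rewrite -cE; lra.
  rewrite v12 in v2y.
  have [xv xvW yv vclear] := BL_feasible s_gt0 BL v1i.
  case: (@BL_lowest _ _ _ _ _ s_gt0 BL c (pos v1) ci);
    rewrite -/(x v1) -/(y v1) //; try lra.
  move=> j jc; have := vclear j (ltn_trans jc cv).
  by rewrite -/(x v1) -/(y v1); case=> ?; [constructor 1|constructor 2|
    constructor 3|constructor 4]; lra.
case: vis => vI vx vh vadj vfirst.
have slope k : (k.+1 < i)%N -> p1 < x k -> p2 < y k + s k ->
    y k < y c \/ (k < c)%N /\ y k < y c + s c -> y k - p2 < x k - p1.
  exact: (@left_chain_under (p1, p2) c k Up ci pc' cfirst).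
have vslope := slope v vi vx ltac:(lra) ltac:(left; lra).
(* Otherwise the slope bound places [p] in the left or lower left copy of [v]. *)
have vsmall : s v < x v - p1.
  rewrite ltNge; apply/negP => sv; apply: none; exists v; split => //.
  by apply: in_copy_left => /=; lra.
(* The top of [v] is at least [s c] above [p]; with the slope bound, [c] fits into the strip with
   its left side on the column. *)
have vright : p1 + s c < x v + s v by lra.
(* By its slope, [k] starts below the ray. If it reached [y c], the ray would meet it no earlier
   than [v], and [v], extending beyond [p1 + s c], would overlap it. For [k = v], slope and size put
   the top below [p2 + 2 * s c]. *)
have low k : (k < c)%N -> p1 < x k -> x k < p1 + s c -> p2 < y k + s k ->
    y k < y c + s c -> y k + s k < y c.
  move=> kc xk1 xk2 yk1 yk2; have ki := ltn_trans kc ci.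
  have kslope := slope k (leq_ltn_trans kc ci) xk1 yk1
    (or_intror (conj kc yk2)).
  rewrite ltNge; apply/negP => ktop.
  have xvk := vfirst k ki xk1 ltac:(lra).
  have [kv|/eqP kv] := eqVneq k v; first by rewrite kv in ktop xk2; lra.
  by case: (squares_apart s_gt0 BL ki vI kv); rewrite -/(x _) -/(y _);
    have := s_gt0 ki; lra.
(* [t] is the height at which [c] comes to rest on the obstructing squares, with [p2] as default. *)
have [t [t0 tub tE]] := bounded_max (fun k => [/\ p1 < x k, x k < p1 + s c,
  p2 < y k + s k & y k < y c + s c]) (fun k => y k + s k) p2 c.
have tc : t < y c.
  by case: tE => [->|[k [kc [? ? ? ?] ->]]] //; exact: low.
have vW := right_le_W vI.
clear none visible column cadj vh vadj vfirst slope low tE vslope vsmall generic.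
clear v1 vis1 v2 vis2 hlow hc h.
case: (@BL_lowest _ _ _ _ _ s_gt0 BL c (p1, t) ci) => /=; try lra.
move=> j jc /=; have ji := ltn_trans jc ci; have sj := s_gt0 ji.
have [|h1] := le_or_lt (p1 + s c) (x j); first by constructor 1.
have [|h2] := le_or_lt (x j + s j) p1; first by constructor 2.
have [h3|h3] := le_or_lt (y j + s j) p2; first by constructor 4; lra.
have [h4|h4] := le_or_lt (y c + s c) (y j); first by constructor 3; lra.
have [xp|px] := le_or_lt (x j) p1; last by constructor 4; exact: tub.
(* The remaining [j] crosses the column above [p], hence starts no lower than [c] and overlaps
   it. *)
have pj : p2 < y j.
  by case: (piece_off_squares Upiece Up ji) => /=; rewrite -/(x _) -/(y _); lra.
have cj := cfirst j ji ltac:(lra) pj.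
have jc' : j <> c by move=> jE; rewrite jE ltnn in jc.
by case: (squares_apart s_gt0 BL ji ci jc'); rewrite -/(x _) -/(y _); lra.
Qed.

End local_cover.

(** * Small shifts to the right, and counting copies *)

Section perturbation.
Context {R : realType}.

Lemma eventually_forall (Q : nat -> R -> Prop) m :
  (forall j, (j < m)%N -> exists2 e0, 0 < e0 & forall e, 0 < e < e0 -> Q j e) ->
  exists2 e0, 0 < e0 & forall j e, (j < m)%N -> 0 < e < e0 -> Q j e.
Proof.
elim: m => [|m IH] Qm; first by exists 1.
have [j jm|e1 e10 Q1] := IH; first exact/Qm/ltnW.
have [e2 e20 Q2] := Qm m (leqnn _).
exists (Num.min e1 e2) => [|j e]; first by rewrite lt_min e10 e20.
rewrite ltnS lt_min leq_eqVlt => /orP[/eqP ->|jm] /and3P[e0 h1 h2].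
  by apply: Q2; rewrite e0.
by apply: Q1 => //; rewrite e0.
Qed.

Lemma shift_right_off_sq q a (p : R * R) : ~ sq q a p ->
  exists2 e0, 0 < e0 & forall e, 0 < e < e0 -> ~ sq q a (p.1 + e, p.2).
Proof.
move=> np; have [qp|pq] := leP q.1 p.1.
  exists 1 => // e e0 [/= h1 h2]; apply: np; split => //; lra.
exists (q.1 - p.1) => [|e e0 [/= h1 h2]]; lra.
Qed.

End perturbation.

(** All pairs with first entry [j] come from the single occurrence of [j] in [l]. *)
Lemma count_copies (T : eqType) (f : nat -> seq T) (l : seq nat) m j :
  uniq l -> (forall k, (size (f k) <= m)%N) ->
  (count (fun c => c.1 == j) [seq (k, d) | k <- l, d <- f k] <= m)%N.
Proof.
move=> + fm; have none l' : j \notin l' ->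
    count (fun c => c.1 == j) [seq (k, d) | k <- l', d <- f k] = 0%N.
  elim: l' => //= k l' IH; rewrite inE negb_or => /andP[jk /IH].
  rewrite count_cat => ->; rewrite addn0 count_map.
  by apply/eqP; rewrite -leqn0 leqNgt -has_count; apply/hasPn => d _ /=;
    rewrite eq_sym.
elim: l => //= k l IH /andP[kl ul]; rewrite count_cat count_map.
have [jk|jk] := eqVneq k j.
  rewrite none -?jk // addn0; exact: leq_trans (count_size _ _) (fm k).
rewrite (_ : count _ _ = 0%N) ?IH //.
by apply/eqP; rewrite -leqn0 leqNgt -has_count; apply/hasPn.
Qed.

(** * From points in general position to all points *)

Section point_covered.
Context {R : realType}.
Variables (W : R) (i : nat) (s : nat -> R) (pos : nat -> R * R).
Variable U : set (R * R).
Hypothesis s_gt0 : forall k, (k < i)%N -> 0 < s k.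
Hypothesis BL : BL_packing W i s pos.
Hypothesis Upiece : pieces W s pos i U.
Hypothesis left_or_middle : left_piece W U \/ middle_piece W U.

(** The copies are closed and finitely many, so an uncovered point stays uncovered after a small
    shift to the right. The shift also stays in [U] and can avoid all right sides, which contradicts
    the generic case. *)
Lemma point_covered p : U p -> exists j,
  [/\ (j < i)%N, adjacent_to (sq (pos j) (s j)) U & in_copy s pos j p].
Proof.
have [lsup [dsup [lsupP dsupP]]] := supports_exist s_gt0 BL.
case: p => p1 p2 Up; have [/= Wp p20] := piece_sub_strip Upiece Up.
have off := piece_off_squares Upiece Up.
have nW : p1 <> W.
  move=> pW; rewrite pW in Up.
  exact: (not_right_wall s_gt0 BL Upiece dsupP left_or_middle Up).
have p1W : p1 < W by rewrite lt_neqAle; apply/andP; split; [exact/eqP|lra].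
apply: contrapT => none.
have [e1 e10 free1] : exists2 e0, 0 < e0 & forall j e, (j < i)%N ->
    0 < e < e0 -> ~ sq (pos j) (s j) (p1 + e, p2).
  apply: (@eventually_forall _ (fun j e =>
    ~ sq (pos j) (s j) (p1 + e, p2))) => j ji.
  apply: (@shift_right_off_sq _ (pos j) (s j) (p1, p2)).
  exact: (off_squaresP s pos i (p1, p2)).1.
have [e2 e20 free2] : exists2 e0, 0 < e0 & forall j e, (j < i)%N ->
    0 < e < e0 -> p1 + e <> (pos j).1 + s j.
  apply: (@eventually_forall _ (fun j e => p1 + e <> (pos j).1 + s j)) => j ji.
  have [h|h] := leP ((pos j).1 + s j) p1; first by exists 1 => // e; lra.
  by exists ((pos j).1 + s j - p1) => [|e]; lra.
have [e3 e30 free3] : exists2 e0, 0 < e0 & forall j e, (j < i)%N ->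
    0 < e < e0 -> adjacent_to (sq (pos j) (s j)) U ->
    ~ in_copy s pos j (p1 + e, p2).
  apply: (@eventually_forall _ (fun j e => adjacent_to (sq (pos j) (s j)) U ->
    ~ in_copy s pos j (p1 + e, p2))) => j ji.
  have [adj|nadj] := pselect (adjacent_to (sq (pos j) (s j)) U);
    last by exists 1.
  (* Numbering the four shifts makes the finite intersection argument apply to them too. *)
  pose Q k e := ~ sq ((pos j).1 + (nth (0, 0) (shifts (s j)) k).1,
    (pos j).2 + (nth (0, 0) (shifts (s j)) k).2) (s j) (p1 + e, p2).
  have [k k4|e0 e00 Qe] := @eventually_forall _ Q 4.
    apply: (@shift_right_off_sq _ _ _ (p1, p2)) => pk; apply: none.
    exists j; split => //; exists (nth (0, 0) (shifts (s j)) k) => //.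
    exact: mem_nth.
  exists e0 => // e he _ [d dS dp]; apply: (Qe (index d (shifts (s j))) e _ he).
    by rewrite -index_mem in dS.
  by rewrite nth_index.
have [e [e0 [h0 [h1 [h2 h3]]]]] : exists e,
    0 < e /\ p1 + e < W /\ e < e1 /\ e < e2 /\ e < e3.
  exists (Num.min (W - p1) (Num.min e1 (Num.min e2 e3)) / 2).
  set m := Num.min _ _.
  have m0 : 0 < m by rewrite !lt_min e10 e20 e30 subr_gt0 p1W.
  have : m <= m by [].
  rewrite {2}/m !le_min => /and4P[]; lra.
have Ue : U (p1 + e, p2).
  apply: (horizontal_segment_in_piece Upiece _ Up); first lra.
  move=> t /andP[]; rewrite le_eqVlt => /orP[/eqP <- _|pt te]; first exact: off.
  apply/(off_squaresP s pos i (t, p2)) => j ji.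
  have -> : t = p1 + (t - p1) by lra.
  by apply: free1 => //; lra.
have [j [ji adj inj]] := generic_point_covered s_gt0 BL Upiece lsupP dsupP
  left_or_middle Ue
  (fun j ji => free2 j e ji ltac:(lra)).
by apply: (free3 j e ji) => //; lra.
Qed.

End point_covered.

(** * Assembling the cover *)

Theorem theorem9 (R : realType) (W : R) (n : nat) (s : nat -> R)
  (pos : nat -> (R * R)%type) (i : nat) (U : set (R * R)%type) :
  0 < W ->
  (forall k, (k < n)%N -> 0 < s k <= W) ->
  BL_packing W n s pos ->
  (1 <= i <= n)%N ->
  pieces W s pos i U ->
  left_piece W U \/ middle_piece W U ->
  exists cover : seq (nat * (R * R)%type),
    [/\ (forall c, c \in cover ->
           (c.1 < i)%N /\ adjacent_to (sq (pos c.1) (s c.1)) U),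
        (forall j, (count (fun c => c.1 == j) cover <= 4)%N) &
        U `<=` \bigcup_(c in [set c | c \in cover])
                  sq ((pos c.1).1 + c.2.1, (pos c.1).2 + c.2.2) (s c.1)].
Proof.
move=> _ sW BL /andP[_ ile_n] Upiece Ulm.
have s_gt0 k : (k < i)%N -> 0 < s k.
  by move=> ki; have /andP[] := sW k (leq_trans ki ile_n).
have BLi : BL_packing W i s pos by move=> k ki; apply/BL/(leq_trans ki).
pose adj := [seq j <- iota 0 i | `[< adjacent_to (sq (pos j) (s j)) U >]].
have adjE j : (j \in adj) =
    `[< adjacent_to (sq (pos j) (s j)) U >] && (j < i)%N.
  by rewrite mem_filter mem_iota.
(* Taking all four copies of every adjacent square makes the family independent of the point to be
   covered. *)
exists [seq (j, d) | j <- adj, d <- shifts (s j)]; split.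
- move=> c /allpairsPdep[j [d [+ _ ->]]].
  by rewrite adjE => /andP[/asboolP].
- by move=> j; apply: count_copies => //; apply/filter_uniq/iota_uniq.
- move=> p /(point_covered s_gt0 BLi Upiece Ulm)[j [ji jadj [d dj pd]]].
  exists (j, d); last exact: pd.
  apply/allpairsPdep; exists j, d; split => //.
  by rewrite adjE ji andbT; apply/asboolP.
Qed.
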